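(* Let $\mathcal{M}$ be a Riemannian manifold, $\mathcal{E}$ a Euclidean space with $\dim\mathcal{M}>\dim\mathcal{E}$, $F:\mathcal{M}\to\mathcal{E}$ a differentiable map, and $f(x)=\frac12\|F(x)\|^2$. Suppose that $F$ is continuously differentiable on the level set $\Omega=\{x\in\mathcal{M} : \|F(x)\|\le\|F(x_0)\|\}$ and that $\{x_k\}$ is an infinite sequence generated by the Riemannian inexact Newton dogleg method (described in the context) from the initial point $x_0$. Then every accumulation point $\bar x$ of $\{x_k\}$ is a stationary point of $f$, i.e. $\mathrm{grad}\, f(\bar x)=(\mathrm{D}F(\bar x))^*[F(\bar x)]=0_{\bar x}$.
   Context: Setting. $\mathcal{M}$ is a Riemannian manifold with a retraction $R$; $\mathcal{E}$ is a Euclidean space; $\langle\cdot,\cdot\rangle$ denotes both the Riemannian metric on $\mathcal{M}$ and the inner product on $\mathcal{E}$, with induced norm $\|\cdot\|$. $\mathrm{D}F(x):T_x\mathcal{M}\to T_{F(x)}\mathcal{E}\simeq\mathcal{E}$ is the differential of $F$, $(\mathrm{D}F(x))^*$ its adjoint, $0_x$ the zero of $T_x\mathcal{M}$. The Riemannian gradient of $f$ is $\mathrm{grad}\,f(x)=(\mathrm{D}F(x))^*[F(x)]$. Riemannian inexact Newton dogleg method. Parameters: $x_0\in\mathcal{M}$, $0<t<1$, $0<\sigma_{\max}<1$, $0<\theta_{\max}<1$, $0<\delta_{\min}<1$, $\delta_0\ge\delta_{\min}$, and a sequence $\{\bar\eta_k\}\subset(0,1)$ with $\lim_{k\to\infty}\bar\eta_k=0$.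 For $k=0,1,2,\dots$: (1) Put $\sigma_k=\min\{\sigma_{\max},\|F(x_k)\|\}$, $\eta_k=\min\{\bar\eta_k,\|F(x_k)\|\}$. By the conjugate gradient method applied to $\big(\mathrm{D}F(x_k)\circ(\mathrm{D}F(x_k))^*+\sigma_k\,\mathrm{id}\big)[\Delta z_k]=-F(x_k)$, find $\Delta z_k\in T_{F(x_k)}\mathcal{E}$ such that $\big\|\big(\mathrm{D}F(x_k)\circ(\mathrm{D}F(x_k))^*+\sigma_k\,\mathrm{id}\big)[\Delta z_k]+F(x_k)\big\|\le\eta_k\|F(x_k)\|$ and $\big\|\mathrm{D}F(x_k)\circ(\mathrm{D}F(x_k))^*[\Delta z_k]+F(x_k)\big\|<\|F(x_k)\|$. (2) Define the inexact Newton point $\Delta x_k^{IN}=(\mathrm{D}F(x_k))^*[\Delta z_k]$ and the Cauchy point $$\widehat{\Delta x}_k^{CP}=-\frac{\|(\mathrm{D}F(x_k))^*[F(x_k)]\|^2}{\|\mathrm{D}F(x_k)\circ(\mathrm{D}F(x_k))^*[F(x_k)]\|^2}(\mathrm{D}F(x_k))^*[F(x_k)].$$ The inexact dogleg curve $\widehat\Gamma_k^{DL}\subset T_{x_k}\mathcal{M}$ is the piecewise linear curve joining $0_{x_k}$, $\widehat{\Delta x}_k^{CP}$ and $\Delta x_k^{IN}$, in this order. Choose $\Delta x_k\in\widehat\Gamma_k^{DL}$ with $\min\{\delta_{\min},\|\Delta x_k^{IN}\|\}\le\|\Delta x_k\|\le\delta_k$. (3) Let $\mathrm{Ared}_k(\Delta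 x_k)=\|F(x_k)\|-\|F(R_{x_k}(\Delta x_k))\|$ and $\mathrm{Pred}_k(\Delta x_k)=\|F(x_k)\|-\|F(x_k)+\mathrm{D}F(x_k)[\Delta x_k]\|$. While $\mathrm{Ared}_k(\Delta x_k)<t\,\mathrm{Pred}_k(\Delta x_k)$: if $\delta_k=\delta_{\min}$, stop (breakdown); otherwise choose $\theta_k\in(0,\theta_{\max}]$, replace $\delta_k$ by $\max\{\theta_k\delta_k,\delta_{\min}\}$, and choose a new $\Delta x_k\in\widehat\Gamma_k^{DL}$ with $\min\{\delta_{\min},\|\Delta x_k^{IN}\|\}\le\|\Delta x_k\|\le\delta_k$. (4) Set $x_{k+1}=R_{x_k}(\Delta x_k)$, with $\Delta x_k$ the finally accepted vector, and choose any $\delta_{k+1}\in[\delta_{\min},\infty)$. An infinite sequence generated by the method is one for which all these steps can be carried out for every $k\ge0$ without breakdown. *)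

(* Defs.v *)
From HB Require Import structures.
From mathcomp Require Import all_boot all_order all_algebra.
From mathcomp Require Import all_classical all_reals all_analysis.
Import Order.TTheory GRing.Theory Num.Theory numFieldNormedType.Exports.

Set Implicit Arguments.
Unset Strict Implicit.
Unset Printing Implicit Defensive.

Local Open Scope classical_set_scope.
Local Open Scope ring_scope.

Record inner_product (R : realType) (V : lmodType R) (ip : V -> V -> R) : Prop :=
  InnerProduct {
    ip_sym : forall u v, ip u v = ip v u;
    ip_lin : forall a u v w, ip (a *: u + v) w = a * ip u w + ip v w;
    ip_pos : forall u, u != 0 -> 0 < ip u u }.

Definition ip_norm (R : realType) (V : lmodType R) (ip : V -> V -> R) (u : V) : R :=
  Num.sqrt (ip u u).

(* The value of the adjoint of the linear map A at w: the v representing the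
   linear form w' |-> <w, A w'>.  It exists and is unique in finite dimension. *)
Definition adjoint (R : realType) (V W : normedModType R)
    (ipV : V -> V -> R) (ipW : W -> W -> R) (A : V -> W) (w : W) : V :=
  get [set v | forall v', ipV v v' = ipW w (A v')].

Record euclideanSpace (R : realType) (n : nat) := EuclideanSpace {
  euc_space :> normedModType R;
  dot : euc_space -> euc_space -> R;
  dotP : inner_product dot;
  norm_dot : forall u : euc_space, `|u| = ip_norm dot u;
  euc_basis : exists b : 'I_n -> euc_space,
    forall u, exists! c : 'rV[R]_n, u = \sum_(i < n) c ord0 i *: b i }.
Arguments dot {R n e} _ _.

(* f is of class C^k on U; meant for U open in a finite-dimensional space. *)
Fixpoint Ck_on (R : realType) (V W : normedModType R) (k : nat)
    (U : set V) (f : V -> W) : Prop :=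
  match k with
  | 0 => forall u, U u -> {for u, continuous f}
  | k'.+1 => (forall u, U u -> differentiable f u) /\
             (forall v, Ck_on k' U (fun u => 'd f u v))
  end.

Definition smooth_on (R : realType) (V W : normedModType R)
  (U : set V) (f : V -> W) : Prop := forall k, Ck_on k U f.

(* [chart_map] matters only on [chart_dom], and [chart_inv] only on
   [chart_map @` chart_dom]. *)
Record chart (R : realType) (M : topologicalType) (m : nat) := Chart {
  chart_dom : set M;
  chart_map : M -> 'rV[R]_m;
  chart_inv : 'rV[R]_m -> M;
  chart_dom_open : open chart_dom;
  chart_img_open : open (chart_map @` chart_dom);
  chart_mapK : forall p, chart_dom p -> chart_inv (chart_map p) = p;
  chart_map_cont : {within chart_dom, continuous chart_map};
  chart_inv_cont : {within chart_map @` chart_dom, continuous chart_inv} }.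

Record manifold (R : realType) (m : nat) := Manifold {
  man_space :> topologicalType;
  man_hausdorff : hausdorff_space man_space;
  man_second_countable : @second_countable man_space;
  atlas : set (chart R man_space m);
  chart_at : man_space -> chart R man_space m;
  chart_at_atlas : forall p, atlas (chart_at p);
  chart_at_dom : forall p, chart_dom (chart_at p) p;
  atlas_smooth : forall c d, atlas c -> atlas d ->
    smooth_on (chart_map c @` (chart_dom c `&` chart_dom d))
      (chart_map d \o chart_inv c) }.
Arguments atlas {R m} _.

(* A tangent vector at p is represented by its components in the distinguished
   chart at p.  Its vector space topology is that of R^m; the Riemannian norm
   is [tnorm] below and not the library norm `|v|. *)
Definition tangent (R : realType) (m : nat) (M : manifold R m) (p : M) :
  normedModType R := 'rV[R]_m.

Section Calculus.
Context {R : realType} {m : nat} {M : manifold R m}.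

(* The tangent vector at p whose components in the chart c are v. *)
Definition tangent_of (c : chart R M m) (p : M) (v : 'rV[R]_m) : tangent p :=
  'd (chart_map (chart_at p) \o chart_inv c) (chart_map c p) v.

Definition differentiable_at (W : normedModType R) (F : M -> W) (p : M) : Prop :=
  differentiable (F \o chart_inv (chart_at p)) (chart_map (chart_at p) p).

Definition differential (W : normedModType R) (F : M -> W) (p : M)
    (v : tangent p) : W :=
  'd (F \o chart_inv (chart_at p)) (chart_map (chart_at p) p) v.

(* In every chart the partial derivatives of F are continuous functions of the
   point p, as p varies in A. *)
Definition continuously_differentiable_on (W : normedModType R) (A : set M)
    (F : M -> W) : Prop :=
  (forall p, A p -> differentiable_at F p) /\
  (forall c, atlas M c -> forall v,
    {within A `&` chart_dom c,
      continuous (fun p => 'd (F \o chart_inv c) (chart_map c p) v)}).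

End Calculus.

Record riemannianManifold (R : realType) (m : nat) := RiemannianManifold {
  riem_manifold :> manifold R m;
  metric : forall p : riem_manifold, tangent p -> tangent p -> R;
  metricP : forall p, inner_product (@metric p);
  metric_smooth : forall c, atlas riem_manifold c -> forall v w,
    smooth_on (chart_map c @` chart_dom c)
      (fun u => @metric (chart_inv c u) (tangent_of c (chart_inv c u) v)
                                     (tangent_of c (chart_inv c u) w)) }.
Arguments metric {R m} _ _ _ _.

(* Smoothness is that of a map from the tangent bundle, read in the bundle
   charts (u, v) |-> (p, tangent vector at p with components v), p = chart_inv c u;
   openness of the set on which the reading is defined expresses continuity. *)
Record retraction (R : realType) (m : nat) (M : manifold R m)
    (retr : forall p : M, tangent p -> M) : Prop := Retraction {
  retr_smooth : forall c d, atlas M c -> atlas M d ->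
    let r (z : 'rV[R]_m * 'rV[R]_m) :=
      retr (chart_inv c z.1) (tangent_of c (chart_inv c z.1) z.2) in
    let U := [set z | (chart_map c @` chart_dom c) z.1 /\ chart_dom d (r z)] in
    open U /\ smooth_on U (fun z => chart_map d (r z));
  retr0 : forall p, retr p 0 = p;
  retr_diff : forall p,
    is_diff (0 : tangent p) (fun v => chart_map (chart_at p) (retr p v) : tangent p)
      id }.

Section RiemannianGradient.
Context {R : realType} {m : nat} {M : riemannianManifold R m}.

Definition tnorm (p : M) (v : tangent p) : R := ip_norm (metric M p) v.

Definition grad (f : M -> R) (p : M) : tangent p :=
  get [set w | forall v, metric M p w v = differential f v].

Definition dF_adj (n : nat) (E : euclideanSpace R n) (F : M -> E) (p : M)
    (e : E) : tangent p :=
  adjoint (metric M p) dot (@differential R m M E F p) e.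

Definition dFdF_adj (n : nat) (E : euclideanSpace R n) (F : M -> E) (p : M)
    (e : E) : E :=
  differential F (dF_adj F p e).

End RiemannianGradient.

(* The conjugate gradient method for A z = b; the state is (iterate, residual,
   search direction). *)
Definition cg_step (R : realType) (n : nat) (E : euclideanSpace R n)
    (A : E -> E) (s : E * E * E) : E * E * E :=
  let: (z, r, d) := s in
  let a := dot r r / dot d (A d) in
  let r' := r - a *: A d in
  (z + a *: d, r', r' + (dot r' r' / dot r r) *: d).

(* The initial guess z0 of the method is left free. *)
Definition cg_iterate (R : realType) (n : nat) (E : euclideanSpace R n)
    (A : E -> E) (b z : E) : Prop :=
  exists (z0 : E) (j : nat),
    z = (iter j (cg_step A) (z0, b - A z0, b - A z0)).1.1.

Section DoglegMethod.
Context {R : realType} {m n : nat} {M : riemannianManifold R m}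
  {E : euclideanSpace R n}.
Variables (retr : forall p : M, tangent p -> M) (F : M -> E).
Variables (t sigma_max theta_max delta_min : R).

Definition inexact_newton_eq (eta_bar : R) (x : M) (z : E) : Prop :=
  let sigma := Num.min sigma_max `|F x| in
  let eta := Num.min eta_bar `|F x| in
  let A (e : E) := dFdF_adj F x e + sigma *: e in
  [/\ cg_iterate A (- F x) z,
      `|A z + F x| <= eta * `|F x| &
      `|dFdF_adj F x z + F x| < `|F x|].

(* Requires dF_adj F x (F x) != 0, which holds as soon as [inexact_newton_eq]
   has a solution at x. *)
Definition cauchy_point (x : M) : tangent x :=
  - (tnorm (dF_adj F x (F x)) ^+ 2 / `|dFdF_adj F x (F x)| ^+ 2)
    *: dF_adj F x (F x).

Definition dogleg_curve (x : M) (IN : tangent x) : set (tangent x) :=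
  let CP := cauchy_point x in
  [set s *: CP | s in `[0, 1]] `|` [set CP + s *: (IN - CP) | s in `[0, 1]].

Definition dogleg_choice (x : M) (IN : tangent x) (delta : R)
    (v : tangent x) : Prop :=
  dogleg_curve IN v /\
  Num.min delta_min (tnorm IN) <= tnorm v <= delta.

Definition Ared (x : M) (v : tangent x) : R := `|F x| - `|F (retr v)|.

Definition Pred (x : M) (v : tangent x) : R :=
  `|F x| - `|F x + differential F v|.

(* [reduction_loop IN delta v v']: entered with radius delta and trial step v,
   the while loop terminates without breakdown, with accepted step v'. *)
Inductive reduction_loop (x : M) (IN : tangent x) :
    R -> tangent x -> tangent x -> Prop :=
| loop_accept delta v :
    t * Pred v <= Ared v -> reduction_loop IN delta v v
| loop_reduce delta v theta v1 v' :
    Ared v < t * Pred v ->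
    delta != delta_min ->
    0 < theta <= theta_max ->
    dogleg_choice IN (Num.max (theta * delta) delta_min) v1 ->
    reduction_loop IN (Num.max (theta * delta) delta_min) v1 v' ->
    reduction_loop IN delta v v'.

Definition dogleg_iteration (eta_bar delta : R) (x x' : M) : Prop :=
  exists (z : E) (v v' : tangent x),
    let IN := dF_adj F x z in
    [/\ inexact_newton_eq eta_bar x z,
        dogleg_choice IN delta v,
        reduction_loop IN delta v v' &
        x' = retr v'].

(* delta k is the trust-region radius at the start of iteration k. *)
Definition generated_by_dogleg (eta_bar : nat -> R) (delta0 : R) (x0 : M)
    (x : nat -> M) : Prop :=
  x 0%N = x0 /\
  exists delta : nat -> R,
    [/\ delta 0%N = delta0,
        (forall k, delta_min <= delta k.+1) &
        (forall k, dogleg_iteration (eta_bar k) (delta k) (x k) (x k.+1))].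

End DoglegMethod.

(* Main.v *)
Require Import Defs.
From HB Require Import structures.
From mathcomp Require Import all_boot all_order all_algebra.
From mathcomp Require Import all_classical all_reals all_analysis.
From mathcomp Require Import ring lra.
Import Order.TTheory GRing.Theory Num.Theory numFieldNormedType.Exports.

Local Open Scope classical_set_scope.
Local Open Scope ring_scope.

(** Stationarity of the accumulation points of the inexact dogleg method.

    Write J = DF(x), g = J^*F(x), and Pred for the decrease of the norm of the
    linear model F(x) + J v.  An accepted step satisfies Ared >= t Pred, so the
    norms |F(x_k)| are nonincreasing as soon as Pred >= 0 on the dogleg curve;
    being bounded below by 0 they converge, and the drops |F(x_k)| - |F(x_{k+1})|
    tend to 0.  If g did not vanish at the accumulation point xbar, every
    iterate close enough to xbar and late enough would satisfy Pred >= eps for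
    a fixed eps > 0, and the sequence comes close to xbar infinitely often:
    a contradiction.

    The uniform bound on Pred ([dogleg_Pred_bounded_below]) needs only three
    facts that persist near xbar: an upper bound L on the operator norm of J,
    a lower bound gamma on |g|, and two-sided positive bounds on |F|.
    - The Cauchy point minimizes the model along -g, and
      Pred(CP) >= |g|^2 / (2 |F| L^2) ([model_decrease_cauchy_ge]).
    - The Newton point is IN = J^*z with r = (J J^* + sigma) z + F small.
      Applying J^* to this identity gives |IN| >= c > 0
      ([newton_point_norm_ge]).  Expanding |(J J^* + sigma) z|^2 gives
      sigma^2 |z|^2 + 2 sigma |IN|^2 <= |F - r|^2, hence sigma |z| stays
      strictly below |F|; as J IN + F = r - sigma z, Pred(IN) >= c' > 0
      ([model_decrease_newton]).
    - Pred is concave, so on the second segment it is at least the smaller of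
      these two bounds, and at s CP it is at least s Pred(CP).  On the first
      segment s cannot be small: the step has length at least
      min(delta_min, |IN|), while |CP| <= |F|^2 / |g|
      ([cauchy_point_norm_le]).

    The bounds on J and g are obtained in the chart around xbar, where the
    metric coefficients and the partial derivatives of F are continuous;
    compactness of the unit sphere of R^m makes the metric uniformly
    equivalent to the coordinate norm near xbar ([metric_coercive_near]). *)

(** * Inner products *)

Section InnerProduct.
Context {R : realType} {V : lmodType R} {ip : V -> V -> R} (ipP : inner_product ip).

Local Notation "`[ u ]" := (ip_norm ip u) (format "`[ u ]").

Lemma ip_rlin a u v w : ip w (a *: u + v) = a * ip w u + ip w v.
Proof. by rewrite ip_sym// ip_lin// !(ip_sym ipP w). Qed.

Lemma ipDl u v w : ip (u + v) w = ip u w + ip v w.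
Proof. by rewrite -[u]scale1r ip_lin// scale1r mul1r. Qed.

Lemma ip0l w : ip 0 w = 0.
Proof. by apply: (@addIr _ (ip 0 w)); rewrite add0r -ipDl addr0. Qed.

Lemma ipZl a u w : ip (a *: u) w = a * ip u w.
Proof. by rewrite -[a *: u]addr0 ip_lin// ip0l addr0. Qed.

Lemma ipDr u v w : ip w (u + v) = ip w u + ip w v.
Proof. by rewrite ip_sym// ipDl !(ip_sym ipP w). Qed.

Lemma ipZr a u w : ip w (a *: u) = a * ip w u.
Proof. by rewrite ip_sym// ipZl (ip_sym ipP w). Qed.

Lemma ipNl u w : ip (- u) w = - ip u w.
Proof. by rewrite -scaleN1r ipZl mulN1r. Qed.

Lemma ipNr u w : ip w (- u) = - ip w u.
Proof. by rewrite -scaleN1r ipZr mulN1r. Qed.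

Lemma ip_suml (I : finType) (c : I -> V) w :
  ip (\sum_i c i) w = \sum_i ip (c i) w.
Proof.
by apply: (big_morph (ip^~ w)) => [u v|]; [exact: ipDl | exact: ip0l].
Qed.

Lemma ip_sumr (I : finType) (c : I -> V) w :
  ip w (\sum_i c i) = \sum_i ip w (c i).
Proof. by rewrite ip_sym// ip_suml; apply: eq_bigr => i _; rewrite ip_sym. Qed.

Lemma ip_ge0 u : 0 <= ip u u.
Proof.
by have [->|u0] := eqVneq u 0; [rewrite ip0l | exact/ltW/ip_pos].
Qed.

Lemma sqr_ip_norm u : `[u] ^+ 2 = ip u u.
Proof. by rewrite sqr_sqrtr ?ip_ge0. Qed.

Lemma ip_norm_ge0 u : 0 <= `[u].
Proof. exact: sqrtr_ge0. Qed.

Lemma ip_norm_gt0 u : u != 0 -> 0 < `[u].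
Proof. by move=> u0; rewrite sqrtr_gt0 ip_pos. Qed.

Lemma ip_normZ a u : `[a *: u] = `|a| * `[u].
Proof.
by rewrite /ip_norm ipZl ipZr mulrA -expr2 sqrtrM ?sqr_ge0// sqrtr_sqr.
Qed.

Lemma ip_normN u : `[- u] = `[u].
Proof. by rewrite -scaleN1r ip_normZ normrN1 mul1r. Qed.

Lemma cauchy_schwarz u v : `|ip u v| <= `[u] * `[v].
Proof.
have [->|v0] := eqVneq v 0.
  by rewrite ip_sym// ip0l normr0 mulr_ge0 ?ip_norm_ge0.
have vv : 0 < ip v v by exact: ip_pos.
rewrite -ler_sqr ?nnegrE ?mulr_ge0 ?ip_norm_ge0//.
rewrite exprMn !sqr_ip_norm real_normK ?num_real//.
(* ip v v times the component of u orthogonal to v *)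
have := ip_ge0 (ip v v *: u - ip u v *: v).
rewrite !(ipDl, ipDr, ipNl, ipNr, ipZl, ipZr) (ip_sym ipP v u) => h.
have {}h : 0 <= ip v v * (ip u u * ip v v - ip u v ^+ 2) by nra.
by move: h; rewrite pmulr_rge0// subr_ge0.
Qed.

Lemma ip_le_norm u v : ip u v <= `[u] * `[v].
Proof. exact: le_trans (ler_norm _) (cauchy_schwarz u v). Qed.

Lemma ip_normD u v : `[u + v] <= `[u] + `[v].
Proof.
rewrite -ler_sqr ?nnegrE ?addr_ge0 ?ip_norm_ge0//.
have uv := ip_le_norm u v.
rewrite sqrrD !sqr_ip_norm ipDl !ipDr (ip_sym ipP v u); lra.
Qed.

End InnerProduct.

Section Riesz.
Context {R : realType} {m : nat} {ip : 'rV[R]_m -> 'rV[R]_m -> R}.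
Context (ipP : inner_product ip).

Lemma ip_delta (u v : 'rV[R]_m) :
  ip u v = \sum_i v 0 i * ip u (delta_mx 0 i).
Proof.
rewrite {1}(row_sum_delta v) ip_sumr//.
by apply: eq_bigr => i _; rewrite ipZr.
Qed.

(** The Gram matrix of the standard basis is invertible, since a vector of its
    kernel is orthogonal to every vector, itself included; a linear form is
    then represented by its row of coefficients times the inverse. *)
Lemma riesz (phi : {linear 'rV[R]_m -> R}) :
  exists u, forall v, ip u v = phi v.
Proof.
pose G := \matrix_(i, j) ip (delta_mx 0 i) (delta_mx 0 j) : 'M[R]_m.
have GE (u : 'rV[R]_m) j : (u *m G) 0 j = ip u (delta_mx 0 j).
  rewrite mxE {2}(row_sum_delta u) ip_suml//.
  by apply: eq_bigr => i _; rewrite mxE ipZl.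
have G_unit : G \in unitmx.
  rewrite -row_free_unit -kermx_eq0; apply/rowV0P => u /sub_kermxP uG0.
  apply/eqP; apply: contraT => u0.
  have := ip_pos ipP u0.
  by rewrite ip_delta big1 ?ltxx// => i _; rewrite -GE uG0 mxE mulr0.
exists ((\row_j phi (delta_mx 0 j)) *m invmx G) => v.
rewrite ip_delta {2}(row_sum_delta v) linear_sum; apply: eq_bigr => i _.
by rewrite -GE mulmxKV// mxE linearZ.
Qed.

End Riesz.

(** * Decrease of the linear model at the Cauchy and Newton points *)

(** A gap between squares becomes a gap between the numbers because
    a^2 - b^2 = (a - b) (a + b) and b <= a. *)
Lemma sub_ge_of_sqr (R : realFieldType) (a b c : R) :
  0 < a -> 0 <= b -> 0 <= c -> b ^+ 2 + c <= a ^+ 2 -> c / (2 * a) <= a - b.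
Proof.
move=> a0 b0 c0 h; rewrite ler_pdivrMr ?mulr_gt0//.
have ba : b <= a.
  rewrite -ler_sqr ?nnegrE ?(ltW a0)//; lra.
nra.
Qed.

Section LinearModel.
Context {R : realType} {n : nat} {V : lmodType R} {ip : V -> V -> R}.
Context (ipP : inner_product ip) {E : euclideanSpace R n}.
Context {J : {linear V -> E}} {Js : E -> V}.
Context (adjP : forall w v, ip (Js w) v = dot w (J v)).

Local Notation "`[ u ]" := (ip_norm ip u) (format "`[ u ]").

Lemma sqr_norm_dot (u : E) : `|u| ^+ 2 = dot u u.
Proof. by rewrite norm_dot sqr_ip_norm//; exact: dotP. Qed.

Lemma dot_le_norm (u v : E) : dot u v <= `|u| * `|v|.
Proof. by rewrite !norm_dot ip_le_norm//; exact: dotP. Qed.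

(** The adjoint of J is given only through its defining identity, which
    determines it by nondegeneracy; linearity follows. *)
Lemma adj_linear a u v : Js (a *: u + v) = a *: Js u + Js v.
Proof.
apply/eqP; rewrite -subr_eq0; apply: contraT => h.
have := ip_pos ipP h.
set w := (X in ip X X); rewrite {1}/w ipDl// ipNl// ip_lin// !adjP.
by rewrite ip_lin ?subrr ?ltxx//; exact: dotP.
Qed.

Lemma sqr_adj_norm w : `[Js w] ^+ 2 = dot w (J (Js w)).
Proof. by rewrite sqr_ip_norm// adjP. Qed.

(** |J^*w|^2 = <w, J J^*w> <= |w| L |J^*w|. *)
Lemma adj_norm_le L w : 0 <= L -> (forall u, `|J u| <= L * `[u]) ->
  `[Js w] <= L * `|w|.
Proof.
move=> L0 JL; have [->|w0] := eqVneq (`[Js w]) 0; first by rewrite mulr_ge0.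
rewrite -(@ler_pM2l _ (`[Js w])) ?lt_def ?w0 ?ip_norm_ge0// -expr2 sqr_adj_norm.
apply: le_trans (dot_le_norm _ _) _.
by have := ler_wpM2l (normr_ge0 w) (JL (Js w)); lra.
Qed.

Definition model_decrease (f : E) (v : V) : R := `|f| - `|f + J v|.

(** Concavity of the decrease, from convexity of the norm. *)
Lemma model_decrease_segment f u v s : 0 <= s <= 1 ->
  (1 - s) * model_decrease f u + s * model_decrease f v
    <= model_decrease f (u + s *: (v - u)).
Proof.
move=> /andP[s0 s1]; rewrite /model_decrease.
have -> : f + J (u + s *: (v - u)) = (1 - s) *: (f + J u) + s *: (f + J v).
  rewrite linearD linearZ/= linearB !scalerDr !scalerBl !scale1r scalerN.
  rewrite addrACA subrK; congr (_ + _).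
  by rewrite [s *: J v - _]addrC addrA.
have := ler_normD ((1 - s) *: (f + J u)) (s *: (f + J v)).
rewrite !normrZ (ger0_norm s0) ger0_norm ?subr_ge0//; lra.
Qed.

Lemma model_decrease0 f : model_decrease f 0 = 0.
Proof. by rewrite /model_decrease linear0 addr0 subrr. Qed.

Definition model_cauchy_point (f : E) : V :=
  - (`[Js f] ^+ 2 / `|J (Js f)| ^+ 2) *: Js f.

Lemma sqr_adj_le f : `[Js f] ^+ 2 <= `|f| * `|J (Js f)|.
Proof. by rewrite sqr_adj_norm; exact: dot_le_norm. Qed.

(** The Cauchy point removes from f its component along J J^*f, whose squared
    length is (<f, J J^*f> / |J J^*f|)^2 = (|J^*f|^2 / |J J^*f|)^2.  When J^*f = 0
    both sides vanish, divisions by zero included. *)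
Lemma model_decrease_cauchy f : 0 < `|f| ->
  (`[Js f] ^+ 2 / `|J (Js f)|) ^+ 2 / (2 * `|f|)
    <= model_decrease f (model_cauchy_point f).
Proof.
move=> f0; set g := Js f.
have [g0|gn0] := eqVneq g 0.
  rewrite /model_cauchy_point -/g g0 scaler0 model_decrease0 linear0 normr0.
  by rewrite invr0 mulr0 expr0n mul0r.
have G0 : 0 < `[g] by exact: ip_norm_gt0.
have := sqr_adj_le f; rewrite -/g => gJ.
have Jg0 : 0 < `|J g|.
  rewrite -(pmulr_rgt0 _ f0); apply: lt_le_trans gJ; exact: exprn_gt0.
rewrite /model_decrease /model_cauchy_point -/g.
set a := `[g] ^+ 2 / `|J g| ^+ 2.
apply: sub_ge_of_sqr => //; first exact: sqr_ge0.
have dP := @dotP _ _ E.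
rewrite sqr_norm_dot linearZ/= !(ipDl dP, ipDr dP, ipZl dP, ipZr dP).
rewrite (ip_sym dP (J g) f) -sqr_adj_norm -!sqr_norm_dot -/g le_eqVlt.
by apply/orP; left; apply/eqP; rewrite /a; field; rewrite gt_eqF.
Qed.

Lemma model_decrease_cauchy_ge f L : 0 < `|f| -> 0 < L ->
  (forall u, `|J u| <= L * `[u]) ->
  `[Js f] ^+ 2 / (2 * `|f| * L ^+ 2) <= model_decrease f (model_cauchy_point f).
Proof.
move=> f0 L0 JL; apply: le_trans (model_decrease_cauchy _ f0).
rewrite [2 * _ * _]mulrC invfM mulrA ler_wpM2r ?invr_ge0 ?mulr_ge0//.
rewrite -expr_div_n ler_sqr ?nnegrE ?divr_ge0 ?exprn_ge0 ?ip_norm_ge0 ?(ltW L0)//.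
have [J0|J0] := eqVneq (`|J (Js f)|) 0.
  have := sqr_adj_le f; rewrite J0 mulr0 => G0.
  have /eqP := le_anti (introT andP (conj G0 (sqr_ge0 _))).
  by rewrite sqrf_eq0 => /eqP ->; rewrite mul0r expr0n mul0r.
have {}J0 : 0 < `|J (Js f)| by rewrite lt_def J0/=.
rewrite ler_pdivlMr// mulrAC ler_pdivrMr// expr2 -mulrA.
by rewrite ler_wpM2l ?ip_norm_ge0// mulrC JL.
Qed.

(** The length of the Cauchy point is |J^*f|^3 / |J J^*f|^2, and
    |J J^*f| >= |J^*f|^2 / |f| by Cauchy-Schwarz. *)
Lemma cauchy_point_norm_le f : Js f != 0 ->
  `[model_cauchy_point f] <= `|f| ^+ 2 / `[Js f].
Proof.
set g := Js f => g0; have G0 : 0 < `[g] by exact: ip_norm_gt0.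
have := sqr_adj_le f; rewrite -/g => gJ.
have Jg0 : 0 < `|J g|.
  rewrite lt_def normr_ge0 andbT; apply/negP => /eqP Jg0.
  move: gJ; rewrite Jg0 mulr0; have := exprn_gt0 2 G0; lra.
rewrite /model_cauchy_point -/g ip_normZ// normrN ger0_norm; last first.
  by rewrite divr_ge0 ?sqr_ge0.
rewrite ler_pdivlMr// -mulrA mulrAC ler_pdivrMr ?exprn_gt0//.
rewrite -expr2 -[leLHS]expr2 -exprMn ler_sqr ?nnegrE ?exprn_ge0 ?mulr_ge0 ?ip_norm_ge0//.
Qed.

Context {f z : E} {sigma eta L : R}.
Context (f0 : 0 < `|f|) (sigma01 : 0 <= sigma <= 1) (eta0 : 0 <= eta).
Context (L0 : 0 <= L) (JL : forall u, `|J u| <= L * `[u]).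
Context (zP : `|J (Js z) + sigma *: z + f| <= eta * `|f|).

(** Apply J^* to f = r - J J^*z - sigma z, where r is the residual: J^*f is the sum
    of J^*r, of size at most L eta |f|, and of the image of J^*z by an operator of
    norm at most L^2 + 1. *)
Lemma newton_point_norm_ge :
  (`[Js f] - L * (eta * `|f|)) / (L ^+ 2 + 1) <= `[Js z].
Proof.
have [s0 s1] := andP sigma01.
rewrite ler_pdivrMr ?ltr_wpDl ?sqr_ge0// lerBlDr.
set r := J (Js z) + sigma *: z + f.
have fE : f = -1 *: J (Js z) + (- sigma *: z + r).
  by rewrite scaleN1r scaleNr /r addrA -opprD addKr.
rewrite {1}fE !adj_linear scaleN1r scaleNr.
apply: le_trans (ip_normD ipP _ _) _; rewrite ip_normN//.
have h1 := ip_normD ipP (- (sigma *: Js z)) (Js r).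
rewrite ip_normN// ip_normZ// (ger0_norm s0) in h1.
have h2 := adj_norm_le _ (J (Js z)) L0 JL.
have h3 := adj_norm_le _ r L0 JL.
have h4 : L * `|J (Js z)| <= L * (L * `[Js z]) by rewrite ler_wpM2l.
have h5 : L * `|r| <= L * (eta * `|f|) by rewrite ler_wpM2l.
have h6 : sigma * `[Js z] <= `[Js z] by rewrite ler_piMl ?ip_norm_ge0.
lra.
Qed.

(** Expanding the square, |J J^*z + sigma z|^2 exceeds (sigma |z|)^2 by at least
    2 sigma |J^*z|^2, while J J^*z + sigma z = r - f has norm at most (1 + eta) |f|.
    This bounds sigma |z|, hence the model value f + J J^*z = r - sigma z. *)
Lemma model_decrease_newton :
  sigma * `[Js z] ^+ 2 / ((1 + eta) * `|f|) - 2 * eta * `|f|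
    <= model_decrease f (Js z).
Proof.
have [s0 s1] := andP sigma01; have dP := @dotP _ _ E.
pose r := J (Js z) + sigma *: z + f.
have rP : `|r| <= eta * `|f| by exact: zP.
have a0 : 0 < (1 + eta) * `|f| by rewrite mulr_gt0 ?ltr_wpDr.
have h : (2 * (sigma * `[Js z] ^+ 2)) / (2 * ((1 + eta) * `|f|))
    <= (1 + eta) * `|f| - sigma * `|z|.
  apply: sub_ge_of_sqr => //; [exact: mulr_ge0 | exact/mulr_ge0/mulr_ge0/sqr_ge0 |].
  have Be : J (Js z) + sigma *: z = r - f by rewrite /r addrK.
  have h1 : `|r - f| <= (1 + eta) * `|f|.
    by apply: le_trans (ler_normB _ _) _; lra.
  have h1' : `|r - f| ^+ 2 <= ((1 + eta) * `|f|) ^+ 2.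
    by rewrite ler_sqr ?nnegrE ?(ltW a0).
  apply: le_trans h1'.
  rewrite -Be sqr_norm_dot !(ipDl dP, ipDr dP, ipZl dP, ipZr dP).
  rewrite (ip_sym dP (J (Js z)) z) -!sqr_norm_dot -sqr_adj_norm exprMn.
  have := sqr_ge0 `|J (Js z)|; nra.
have h2 : `|f + J (Js z)| <= eta * `|f| + sigma * `|z|.
  have -> : f + J (Js z) = r - sigma *: z.
    by rewrite /r addrAC addrK addrC.
  apply: le_trans (ler_normB _ _) _; rewrite normrZ (ger0_norm s0); lra.
rewrite -mulf_div divff ?mul1r ?pnatr_eq0// in h.
rewrite /model_decrease; lra.
Qed.

End LinearModel.

(** * Change of charts *)

(** Differentials are local; the first order expansion of f transfers to g. *)
Lemma near_eq_diff (R : realType) (V W : normedModType R) (f g : V -> W) (x : V) :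
  {near x, f =1 g} -> differentiable f x ->
  differentiable g x /\ 'd g x = 'd f x :> (V -> W).
Proof.
move=> fg df.
have [dfc dfx] := (diff_locallyP _ _).1 df.
have gx : g \o shift x = cst (g x) + 'd f x +o_ (0 : V) id.
  apply/eqaddoP => e e0; have /eqaddoP/(_ e e0) := dfx.
  have fg0 : \forall h \near (0 : V), f (h + x) = g (h + x).
    have : \forall y \near x, f y = g y by exact: fg.
    by rewrite (near_shift (0 : V)); apply: filterS => h /=; rewrite subr0.
  apply: filter_app; apply: filter_app fg0; apply: filterE => h fgh.
  rewrite /= !fctE/= !fgh.
  by rewrite (nbhs_singleton fg).
have dg := diff_unique dfc gx.
split; last exact: dg.
by apply/diff_locallyP; rewrite dg; split; [exact: dfc | exact: gx].
Qed.

Section Charts.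
Context {R : realType} {m : nat} {M : manifold R m}.
Implicit Types (c d : chart R M m) (p : M).

Lemma chart_dom_near c p : chart_dom c p -> \forall q \near p, chart_dom c q.
Proof. by move=> cp; exact: open_nbhs_nbhs (conj (chart_dom_open c) cp). Qed.

Lemma chart_img_near c p : chart_dom c p ->
  \forall u \near chart_map c p, (chart_map c @` chart_dom c) u.
Proof.
move=> cp; apply: open_nbhs_nbhs; split; first exact: chart_img_open.
by exists p.
Qed.

Lemma chart_map_cvg c p : chart_dom c p -> chart_map c @ p --> chart_map c p.
Proof.
move=> cp; have := @chart_map_cont _ _ _ c.
rewrite continuous_open_subspace; last exact: chart_dom_open.
by apply; rewrite inE.
Qed.

Lemma chart_inv_cvg c p : chart_dom c p -> chart_inv c @ chart_map c p --> p.
Proof.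
move=> cp; have := @chart_inv_cont _ _ _ c.
rewrite continuous_open_subspace; last exact: chart_img_open.
move=> /(_ (chart_map c p)); rewrite /continuous_at chart_mapK//; apply.
by rewrite inE; exists p.
Qed.

Lemma chart_invK c u : (chart_map c @` chart_dom c) u ->
  chart_map c (chart_inv c u) = u.
Proof. by case=> q cq <-; rewrite chart_mapK. Qed.

Lemma chart_transition_diff c d p : atlas M c -> atlas M d ->
  chart_dom c p -> chart_dom d p ->
  differentiable (chart_map d \o chart_inv c) (chart_map c p).
Proof.
move=> Mc Md cp dp; have [h _] := @atlas_smooth _ _ M c d Mc Md 1%N.
by apply: h; exists p.
Qed.

(** Chain rule for F o inv_c = (F o inv_d) o (map_d o inv_c), an identity which
    holds only near the image of p. *)
Lemma chart_change (W : normedModType R) (F : M -> W) c d p :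
    atlas M c -> atlas M d -> chart_dom c p -> chart_dom d p ->
    differentiable (F \o chart_inv d) (chart_map d p) ->
  'd (F \o chart_inv c) (chart_map c p) =
  'd (F \o chart_inv d) (chart_map d p) \o
    'd (chart_map d \o chart_inv c) (chart_map c p) :> (_ -> _).
Proof.
move=> Mc Md cp dp dF.
have dT := chart_transition_diff c d p Mc Md cp dp.
have pE : (chart_map d \o chart_inv c) (chart_map c p) = chart_map d p.
  by rewrite /= chart_mapK.
have dF' : differentiable (F \o chart_inv d)
    ((chart_map d \o chart_inv c) (chart_map c p)) by rewrite pE.
rewrite -[in RHS]pE -(diff_comp dT dF').
have [||_ ->] // := @near_eq_diff _ _ _
  ((F \o chart_inv d) \o (chart_map d \o chart_inv c)) (F \o chart_inv c) (chart_map c p).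
  have near_d : \forall u \near chart_map c p, chart_dom d (chart_inv c u).
    exact: chart_inv_cvg c p cp _ (chart_dom_near d p dp).
  by apply: filterS near_d => u du /=; rewrite chart_mapK.
exact: differentiable_comp dT dF'.
Qed.

(** Differentials are defined in the distinguished chart of each point, which
    may jump from point to point.  This lemma reads them in one fixed chart,
    where continuity makes sense. *)
Lemma differential_tangent_of (W : normedModType R) (F : M -> W) c p v :
  atlas M c -> chart_dom c p -> differentiable_at F p ->
  differential F (tangent_of c p v) = 'd (F \o chart_inv c) (chart_map c p) v.
Proof.
move=> Mc cp dF; rewrite (chart_change _ F c (chart_at p))//.
- exact: chart_at_atlas.
- exact: chart_at_dom.
Qed.

Lemma tangent_of_chart_at p v : tangent_of (chart_at p) p v = v.
Proof.
rewrite /tangent_of; have [||_ ->] := @near_eq_diff _ _ _ id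
  (chart_map (chart_at p) \o chart_inv (chart_at p)) (chart_map (chart_at p) p).
- have := chart_img_near _ _ (chart_at_dom p); apply: filterS => u du.
  by rewrite /= chart_invK.
- exact: ex_diff.
by rewrite diff_val.
Qed.

(** The inverse coordinate change provides the components. *)
Lemma tangent_of_surj c p (w : tangent p) : atlas M c -> chart_dom c p ->
  exists v, tangent_of c p v = w.
Proof.
move=> Mc cp; have Md := chart_at_atlas p; have dp := chart_at_dom p.
exists ('d (chart_map c \o chart_inv (chart_at p)) (chart_map (chart_at p) p) w).
have dT := chart_transition_diff _ _ _ Mc Md cp dp.
have dId := chart_change _ (chart_map (chart_at p)) (chart_at p) c p Md Mc dp cp dT.
rewrite -[RHS](tangent_of_chart_at p w).
exact: (esym (congr1 (fun g => g w) dId)).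
Qed.

End Charts.

(** * The gradient of half the squared norm *)

Section HalfSquaredNorm.
Context {R : realType} {n : nat} {E : euclideanSpace R n}.

(** Polarization reduces the convergence of inner products to that of norms. *)
Lemma cvg_dot (T : Type) (G : set_system T) (u v : T -> E) (a b : E) :
  Filter G -> u @ G --> a -> v @ G --> b ->
  (fun x => dot (u x) (v x)) @ G --> dot a b.
Proof.
move=> FG ua vb.
have polar (x y : E) :
    dot x y = 2^-1 * ((`|x + y| * `|x + y| - `|x| * `|x|) - `|y| * `|y|).
  have dP := @dotP _ _ E.
  rewrite -!expr2 !sqr_norm_dot !(ipDl dP, ipDr dP) (ip_sym dP y x); lra.
rewrite polar (_ : (fun x => _) = (fun x => 2^-1 * ((`|u x + v x| * `|u x + v x| -
  `|u x| * `|u x|) - `|v x| * `|v x|))); last by apply/funext => x; exact: polar.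
have uv : `|u x + v x| @[x --> G] --> `|a + b| by apply: cvg_norm; exact: cvgD.
have nu : `|u x| @[x --> G] --> `|a| by exact: cvg_norm.
have nv : `|v x| @[x --> G] --> `|b| by exact: cvg_norm.
apply: cvgM; first exact: cvg_cst.
apply: cvgB; last exact: (cvgM nv nv).
by apply: cvgB; [exact: (cvgM uv uv) | exact: (cvgM nu nu)].
Qed.

Lemma dot_continuous (e : E) : continuous (dot e : E -> R).
Proof. by move=> d; apply: cvg_dot; [exact: cvg_cst | exact: cvg_id]. Qed.

(** The remainder of the first order expansion at e is |d|^2 / 2. *)
Lemma is_diff_half_sqr_norm (e : E) :
  is_diff e (fun d : E => 2^-1 * `|d| ^+ 2 : R) (dot e).
Proof.
have dP := @dotP _ _ E.
have dlin : linear (dot e : E -> R) by move=> a u v; rewrite ip_rlin.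
pose dlM := GRing.isLinear.Build _ _ _ _ _ dlin.
pose dL : {linear E -> R} := HB.pack (dot e : E -> R) dlM.
have dc : continuous dL by exact: dot_continuous.
have exp : (fun d : E => 2^-1 * `|d| ^+ 2 : R) \o shift e
    = cst (2^-1 * `|e| ^+ 2) + dL +o_ (0 : E) id.
  apply/eqaddoP => eps eps0; near=> d.
  rewrite /= !fctE /= !sqr_norm_dot !(ipDl dP, ipDr dP) (ip_sym dP d e).
  have square (a b c : R) :
    2^-1 * (a + b + (b + c)) - (2^-1 * c + b) = 2^-1 * a by field.
  have half_small (a : R) : 0 <= a -> a <= eps -> `|2^-1 * a ^+ 2| <= eps * a.
    by move=> a0 ae; rewrite ger0_norm; [nra | rewrite mulr_ge0 ?sqr_ge0].
  rewrite square -sqr_norm_dot; apply: half_small; first exact: normr_ge0.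
  by near: d; apply: cvgr_norm_le; [exact: cvg_id | rewrite normr0].
have dE := diff_unique dc exp.
apply: DiffDef; last exact: dE.
by apply/diff_locallyP; rewrite dE; split; [exact: dc | exact: exp].
Unshelve. all: by end_near. Qed.

End HalfSquaredNorm.

Section RiemannianGradient.
Context {R : realType} {m n : nat} {M : riemannianManifold R m}.
Context {E : euclideanSpace R n} (F : M -> E) (p : M).

Lemma dF_adjP w (v : tangent p) :
  metric M p (dF_adj F p w) v = dot w (differential F v).
Proof.
have dP := @dotP _ _ E.
pose phi (v : 'rV[R]_m) := dot w (differential F (v : tangent p)) : R.
have phi_lin : linear phi.
  by move=> a u v'; rewrite /phi /differential linearP ip_rlin.
pose phiM := GRing.isLinear.Build _ _ _ _ _ phi_lin.
pose phiL : {linear 'rV[R]_m -> R} := HB.pack phi phiM.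
have [u uP] := riesz (metricP p) phiL.
have := @getPex _ [set u : tangent p |
  forall v', metric M p u v' = dot w (differential F v')].
by apply; exists u => v'; exact: uP.
Qed.

(** By the chain rule the differential of half the squared norm of F is
    v |-> <F(p), DF(p) v>, so the gradient and the adjoint are the canonical
    choice in one and the same set. *)
Lemma grad_half_sqr_norm : differentiable_at F p ->
  grad (fun q => 2^-1 * `|F q| ^+ 2) p = dF_adj F p (F p).
Proof.
move=> dF; rewrite /grad /dF_adj /adjoint; congr (get _).
apply/seteqP; split => w /= h v; rewrite h /differential;
  have := @is_diff_comp _ _ _ _ _ _ _ _ _ (differentiableP dF)
    (is_diff_half_sqr_norm ((F \o chart_inv (chart_at p)) (chart_map (chart_at p) p)));
  case=> _ /(congr1 (@^~ v)) /=; rewrite (chart_mapK (chart_at_dom p)) => <- //.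
Qed.

End RiemannianGradient.

(** * Uniform bounds near a point *)

Lemma cvg_fin_sum (R : realType) (I : finType) (T : Type) (G : set_system T)
    (f : I -> T -> R) (a : I -> R) : Filter G ->
  (forall i, f i @ G --> a i) -> (fun x => \sum_i f i x) @ G --> \sum_i a i.
Proof. by move=> FG fa; apply: cvg_big => //; exact: add_continuous. Qed.

Section QuadraticForms.
Context {R : realType} {m : nat}.

Lemma normr_coord_le (v : 'rV[R]_m) i : `|v 0 i| <= `|v|.
Proof.
rewrite [leRHS]mx_normrE.
exact: (le_bigmax (0 : R) (fun ij : 'I_1 * 'I_m => `|v ij.1 ij.2|) (0, i)).
Qed.

Lemma ip_expand (V : lmodType R) (ip : V -> V -> R) (T : {linear 'rV[R]_m -> V})
    (v : 'rV[R]_m) : inner_product ip ->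
  ip (T v) (T v) =
  \sum_i \sum_j v 0 i * v 0 j * ip (T (delta_mx 0 i)) (T (delta_mx 0 j)).
Proof.
move=> ipP; rewrite {1}(row_sum_delta v) linear_sum ip_suml//.
apply: eq_bigr => i _; rewrite linearZ/= ipZl// {2}(row_sum_delta v) linear_sum.
rewrite ip_sumr// mulr_sumr; apply: eq_bigr => j _.
by rewrite linearZ/= ipZr// mulrA.
Qed.

Lemma quad_continuous (ip : 'rV[R]_m -> 'rV[R]_m -> R) :
  inner_product ip -> continuous (fun v => ip v v).
Proof.
move=> ipP v.
have E (u : 'rV[R]_m) : ip u u = \sum_i \sum_j
    u 0 i * u 0 j * ip (delta_mx 0 i) (delta_mx 0 j).
  by rewrite -(ip_expand _ _ idfun).
rewrite /continuous_at E; under eq_fun do rewrite E.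
apply: (@cvg_fin_sum _ _ _ (nbhs v)) => i.
apply: (@cvg_fin_sum _ _ _ (nbhs v)) => j.
apply: (@cvgM _ _ _ _ (fun u : 'rV[R]_m => u 0 i * u 0 j)); last exact: cvg_cst.
apply: (@cvgM _ _ _ _ (fun u : 'rV[R]_m => u 0 i) (fun u => u 0 j));
  exact: coord_continuous.
Qed.

(** The minimum of the quadratic form on the compact unit sphere of the
    coordinate norm. *)
Lemma inner_product_coercive (ip : 'rV[R]_m -> 'rV[R]_m -> R) :
  inner_product ip -> exists2 mu, 0 < mu & forall v, mu * `|v| ^+ 2 <= ip v v.
Proof.
move=> ipP; pose S := [set v : 'rV[R]_m | `|v| = 1].
have unit (v : 'rV[R]_m) : v != 0 -> S (`|v|^-1 *: v).
  by move=> v0; rewrite /S/= normrZ normfV normr_id mulVf// normr_eq0.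
(* the sphere is empty when m = 0 *)
have [S0|S0] := pselect (S !=set0); last first.
  exists 1 => // v; have [->|v0] := eqVneq v 0.
    by rewrite normr0 expr0n mulr0 ip0l.
  by exfalso; apply: S0; exists (`|v|^-1 *: v); exact: unit.
have Sc : compact S.
  apply: bounded_closed_compact.
    by exists 1; split; [exact: num_real | move=> x x1 v /= ->; exact: ltW].
  have -> : S = (fun v : 'rV[R]_m => `|v|) @^-1` [set (1 : R)] by [].
  apply: preimage_closed; last exact: closed_eq.
  by move=> v _; exact: norm_continuous.
have [v0 v0S v0min] := compact_EVT_min S0 Sc
  (continuous_subspaceT (quad_continuous _ ipP)).
exists (ip v0 v0).
  apply: ip_pos => //; apply/eqP => v00.
  by move: v0S; rewrite inE /S/= v00 normr0 => /esym/eqP; rewrite oner_eq0.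
move=> v; have [->|v_neq0] := eqVneq v 0.
  by rewrite normr0 expr0n mulr0 ip0l.
have := v0min (`|v|^-1 *: v); rewrite inE => /(_ (unit _ v_neq0)).
rewrite ipZl// ipZr// mulrA -expr2 exprVn mulrC ler_pdivlMr//.
by rewrite exprn_gt0// normr_gt0.
Qed.

End QuadraticForms.

Section NearPoint.
Context {R : realType} {m : nat} {M : riemannianManifold R m}.

(** The metric read in one chart, so that continuity in p makes sense. *)
Definition chart_metric (c : chart R M m) (p : M) (v w : 'rV[R]_m) : R :=
  metric M p (tangent_of c p v) (tangent_of c p w).

Lemma chart_metric_cvg (c : chart R M m) (p : M) v w :
  atlas M c -> chart_dom c p ->
  (fun q => chart_metric c q v w) @ p --> chart_metric c p v w.
Proof.
move=> Mc cp.
have cont : {for chart_map c p, continuous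
    (fun u => chart_metric c (chart_inv c u) v w)}.
  by apply: (metric_smooth Mc v w 0%N); exists p.
have lim : chart_metric c (chart_inv c (chart_map c q)) v w @[q --> p]
    --> chart_metric c (chart_inv c (chart_map c p)) v w.
  exact: cvg_comp _ _ (chart_map_cvg c p cp) cont.
rewrite (chart_mapK cp) in lim.
apply: cvg_trans lim; apply: near_eq_cvg.
by apply: filterS (chart_dom_near c p cp) => q cq; rewrite (chart_mapK cq).
Qed.

(** Coercivity at p survives a change of the finitely many coefficients of the
    metric by a total of at most mu / 2. *)
Lemma metric_coercive_near (p : M) : exists2 mu, 0 < mu &
  \forall q \near p, forall v,
    mu * `|v| ^+ 2 <= chart_metric (chart_at p) q v v.
Proof.
set c := chart_at p; have Mc : atlas M c by exact: chart_at_atlas.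
have cp : chart_dom c p by exact: chart_at_dom.
have [mu mu0 muP] := inner_product_coercive _ (metricP p).
exists (mu / 2); first by rewrite divr_gt0.
pose D i j (q : M) := `|chart_metric c q (delta_mx 0 i) (delta_mx 0 j) -
                   chart_metric c p (delta_mx 0 i) (delta_mx 0 j)|.
have near_D : \forall q \near p, \sum_i \sum_j D i j q < mu / 2.
  apply: (cvgr_lt 0); last by rewrite divr_gt0.
  rewrite [X in _ --> X](_ : 0 = \sum_(i < m) \sum_(j < m) (0 : R)); last first.
    by rewrite big1 // => i _; rewrite big1.
  apply: (@cvg_fin_sum _ _ _ (nbhs p)) => i.
  apply: (@cvg_fin_sum _ _ _ (nbhs p)) => j.
  rewrite -[X in _ --> X](@normr0 _ R); apply: cvg_norm.
  rewrite -(subrr (chart_metric c p (delta_mx 0 i) (delta_mx 0 j))).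
  by apply: cvgB; [exact: chart_metric_cvg | exact: cvg_cst].
apply: filterS near_D => q Dq v.
have expand r : chart_metric c r v v = \sum_i \sum_j v 0 i * v 0 j *
    chart_metric c r (delta_mx 0 i) (delta_mx 0 j).
  exact: ip_expand (metricP r).
have at_p : mu * `|v| ^+ 2 <= chart_metric c p v v.
  rewrite /chart_metric !tangent_of_chart_at; exact: muP.
have diff_le : chart_metric c p v v - chart_metric c q v v
    <= `|v| ^+ 2 * \sum_i \sum_j D i j q.
  rewrite !expand -sumrB mulr_sumr; apply: ler_sum => i _.
  rewrite -sumrB mulr_sumr; apply: ler_sum => j _.
  rewrite -mulrBr; apply: le_trans (ler_norm _) _.
  rewrite normrM distrC ler_wpM2r// normrM expr2.
  by rewrite ler_pM ?normr_coord_le.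
have small := ler_wpM2l (sqr_ge0 `|v|) (ltW Dq).
move: at_p diff_le small; move: (chart_metric c p v v) (chart_metric c q v v).
by move: (\sum_i \sum_j D i j q) (`|v| ^+ 2) => *; lra.
Qed.

End NearPoint.

Lemma differentiable_at_cvg {R : realType} {m : nat} {M : manifold R m}
    (W : normedModType R) (F : M -> W) (p : M) :
  differentiable_at F p -> F @ p --> F p.
Proof.
move=> dF; have cp := chart_at_dom p.
have lim : (F \o chart_inv (chart_at p)) (chart_map (chart_at p) q) @[q --> p]
    --> (F \o chart_inv (chart_at p)) (chart_map (chart_at p) p).
  exact: cvg_comp _ _ (chart_map_cvg _ p cp) (differentiable_continuous dF).
rewrite [X in _ --> X]/= (chart_mapK cp) in lim.
apply: cvg_trans lim; apply: near_eq_cvg.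
by apply: filterS (chart_dom_near _ p cp) => q cq; rewrite /= (chart_mapK cq).
Qed.

Section NearContinuouslyDifferentiable.
Context {R : realType} {m n : nat} {M : riemannianManifold R m}.
Context {E : euclideanSpace R n} {F : M -> E} {A : set M}.
Context (F_C1 : continuously_differentiable_on A F) {p : M} (Ap : A p).

Local Notation c := (chart_at p).

(** Unlike [differential], it is read in the chart of p for every q, so that
    continuity in q makes sense. *)
Definition chart_differential (q : M) (v : 'rV[R]_m) : E :=
  'd (F \o chart_inv c) (chart_map c q) v.

Lemma chart_differential_cvg v :
  chart_differential q v @[q --> within A (nbhs p)] --> chart_differential p v.
Proof.
have := F_C1.2 c (chart_at_atlas p) v.
move=> /subspace_continuousP/(_ p (conj Ap (chart_at_dom p))) lim S /lim.
rewrite /= !nbhs_simpl /within/= => near_S.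
apply: filterS2 near_S (chart_dom_near c p (chart_at_dom p)) => q h cq Aq.
exact: h.
Qed.

(** In the chart of p the partial derivatives stay bounded and the coordinate
    norm is controlled by the Riemannian norm; every tangent vector at q has
    components in this chart. *)
Lemma differential_bounded_near : exists2 L, 0 < L &
  \forall q \near within A (nbhs p), forall u : tangent q,
    `|differential F u| <= L * tnorm u.
Proof.
have [mu mu0 near_mu] := metric_coercive_near p.
pose S q := \sum_(i < m) `|chart_differential q (delta_mx 0 i)|.
pose C := S p + 1.
have Sp0 : 0 <= S p by apply: sumr_ge0 => i _.
have C0 : 0 < C by rewrite ltr_wpDl.
have near_S : \forall q \near within A (nbhs p), S q < C.
  apply: (cvgr_lt (S p)); last by rewrite ltrDl.
  apply: cvg_fin_sum => i; apply: cvg_norm; exact: chart_differential_cvg.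
exists (C / Num.sqrt mu); first by rewrite divr_gt0 ?sqrtr_gt0.
have near_Ac : \forall q \near within A (nbhs p), A q /\ chart_dom c q.
  by apply: filterS (chart_dom_near c p (chart_at_dom p)) => q cq Aq.
have near_mu' : \forall q \near within A (nbhs p), forall v,
    mu * `|v| ^+ 2 <= chart_metric c q v v by exact: cvg_within near_mu.
apply: filterS3 near_Ac near_mu' near_S => q [Aq cq] muq Sq u.
have [v <-] := tangent_of_surj c q u (chart_at_atlas p) cq.
rewrite (differential_tangent_of _ F c q v (chart_at_atlas p) cq (F_C1.1 q Aq)).
have dle : `|chart_differential q v| <= C * `|v|.
  have -> : chart_differential q v =
      \sum_i v 0 i *: chart_differential q (delta_mx 0 i).
    rewrite {1}(row_sum_delta v) /chart_differential linear_sum.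
    by apply: eq_bigr => i _; rewrite linearZ.
  apply: le_trans (ler_norm_sum _ _ _) _.
  apply: le_trans (ler_wpM2r (normr_ge0 v) (ltW Sq)).
  rewrite mulr_suml; apply: ler_sum => i _.
  by rewrite normrZ mulrC ler_wpM2l// normr_coord_le.
apply: le_trans dle _; rewrite -mulrA ler_wpM2l ?(ltW C0)//.
rewrite mulrC ler_pdivlMr ?sqrtr_gt0//.
rewrite -ler_sqr ?nnegrE ?mulr_ge0 ?ip_norm_ge0 ?sqrtr_ge0//.
rewrite exprMn sqr_sqrtr ?(ltW mu0)// mulrC /tnorm (sqr_ip_norm (metricP q)).
exact: muq.
Qed.

(** The gradient need not be shown to be continuous: testing it against one
    fixed vector is enough.  For the vectors v_q with the components of
    g = grad f(p) one has |grad f(q)| |v_q| >= <F(q), DF(q) v_q>, and at q = p the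
    right-hand side is |g|^2 > 0. *)
Lemma gradient_bounded_below_near : dF_adj F p (F p) != 0 ->
  exists2 gamma, 0 < gamma &
    \forall q \near within A (nbhs p), gamma <= tnorm (dF_adj F q (F q)).
Proof.
set g := dF_adj F p (F p) => g0.
have a0 : 0 < tnorm g := ip_norm_gt0 (metricP p) g g0.
set a := tnorm g in a0.
have cp := chart_at_dom p; have Mc := chart_at_atlas p.
have Fcvg : F @ within A (nbhs p) --> F p.
  apply: cvg_trans (differentiable_at_cvg _ _ _ (F_C1.1 p Ap)).
  by apply: cvg_app; exact: cvg_within.
have slope : \forall q \near within A (nbhs p),
    a ^+ 2 / 2 < dot (F q) (chart_differential q g).
  apply: cvgr_gt.
    exact: cvg_dot Fcvg (chart_differential_cvg g).
  rewrite -[chart_differential p g]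
    (differential_tangent_of _ F c p g Mc cp (F_C1.1 p Ap)).
  rewrite tangent_of_chart_at -dF_adjP -/g -(sqr_ip_norm (metricP p)) -/(tnorm g).
  by rewrite -/a ltr_pdivrMr// ltr_pMr ?exprn_gt0// ltr1n.
have len : \forall q \near within A (nbhs p), chart_metric c q g g < 4 * a ^+ 2.
  apply: (cvg_within (F := nbhs p)).
  apply: cvgr_lt; first exact: chart_metric_cvg.
  rewrite /chart_metric !tangent_of_chart_at -(sqr_ip_norm (metricP p)) -/(tnorm g).
  by rewrite -/a ltr_pMl ?exprn_gt0// ltr1n.
have near_Ac : \forall q \near within A (nbhs p), A q /\ chart_dom c q.
  by apply: filterS (chart_dom_near c p cp) => q cq Aq.
exists (a / 4); first by rewrite divr_gt0.
apply: filterS3 near_Ac slope len => q [Aq cq] sq lq.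
move: sq; rewrite -[chart_differential q g]
  (differential_tangent_of _ F c q g Mc cq (F_C1.1 q Aq)) -dF_adjP => sq.
have := ip_le_norm (metricP q) (dF_adj F q (F q)) (tangent_of c q g).
rewrite -!/(tnorm _).
have : tnorm (tangent_of c q g) <= 2 * a.
  rewrite -ler_sqr ?nnegrE ?mulr_ge0 ?ip_norm_ge0 ?(ltW a0)//.
  by rewrite exprMn (sqr_ip_norm (metricP q)) -natrX ltW.
have : 0 <= tnorm (dF_adj F q (F q)) by exact: ip_norm_ge0.
move: sq; move: (metric _ _ _ _) (tnorm _) (tnorm _) => *; nra.
Qed.

End NearContinuouslyDifferentiable.

(** * Decrease along the dogleg curve *)

Section DoglegBounds.
Context {R : realType} {m n : nat} {M : riemannianManifold R m}.
Context {E : euclideanSpace R n} (F : M -> E).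
Implicit Types (x : M) (z : E).

Lemma Pred_segment x (u v : tangent x) s : 0 <= s <= 1 ->
  (1 - s) * Pred F u + s * Pred F v <= Pred F (u + s *: (v - u)).
Proof. exact: model_decrease_segment. Qed.

Lemma Pred0 x : Pred F (0 : tangent x) = 0.
Proof. exact: model_decrease0. Qed.

Lemma Pred_cauchy_ge0 x : 0 < `|F x| -> 0 <= Pred F (cauchy_point F x).
Proof.
move=> Fx0.
apply: le_trans (model_decrease_cauchy (metricP x) (dF_adjP F x) (F x) Fx0).
by rewrite divr_ge0 ?sqr_ge0.
Qed.

(** Concavity on each segment.  On the first one, which starts at 0, the
    parameter s is kept because it is the length of the step that bounds it
    from below. *)
Lemma dogleg_curve_Pred x (IN v : tangent x) : dogleg_curve F IN v ->
  (exists2 s, 0 <= s & v = s *: cauchy_point F x /\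
     s * Pred F (cauchy_point F x) <= Pred F v) \/
  Num.min (Pred F (cauchy_point F x)) (Pred F IN) <= Pred F v.
Proof.
case=> -[s]; rewrite /= in_itv/= => /andP[s0 s1] <-; [left|right].
  exists s => //; split => //.
  have := Pred_segment x 0 (cauchy_point F x) s.
  by rewrite Pred0 mulr0 add0r add0r subr0; apply; rewrite s0.
apply: le_trans (Pred_segment _ _ _ s _); last by rewrite s0.
set a := Pred F _; set b := Pred F IN.
have [am bm] : Num.min a b <= a /\ Num.min a b <= b.
  by rewrite !ge_min !lexx orbT.
by move: am bm; move: (Num.min a b) => c; nra.
Qed.

Lemma Pred_newton_gt0 x z :
  `|dFdF_adj F x z + F x| < `|F x| -> 0 < Pred F (dF_adj F x z).
Proof. by rewrite /Pred subr_gt0 [F x + _]addrC. Qed.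

Lemma dogleg_Pred_ge0 x z sigma_max eta_bar v :
  inexact_newton_eq F sigma_max eta_bar x z ->
  dogleg_curve F (dF_adj F x z) v -> 0 <= Pred F v.
Proof.
case=> _ _ lt_Fx; have Fx0 : 0 < `|F x| by exact: le_lt_trans lt_Fx.
have CP0 := Pred_cauchy_ge0 x Fx0.
have IN0 := Pred_newton_gt0 _ _ lt_Fx.
case/dogleg_curve_Pred => [[s s0 [_]]|]; apply: le_trans; first exact: mulr_ge0.
by rewrite le_min CP0 ltW.
Qed.

(** Below, iota bounds |IN| from below, s0 bounds sigma, p1 and p2 bound the
    decrease at the Newton and Cauchy points, and s1 bounds the parameter of a
    step on the first segment.  The threshold eta0 makes L eta |F| at most gamma / 2
    and the loss 2 eta |F| at most p1. *)
Lemma dogleg_Pred_bounded_below (sigma_max delta_min L gamma phi Phi : R) :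
    0 < sigma_max < 1 -> 0 < delta_min -> 0 < L -> 0 < gamma -> 0 < phi ->
  exists2 eps, 0 < eps & exists2 eta0, 0 < eta0 &
    forall x z eta_bar delta (v : tangent x),
      (forall u : tangent x, `|differential F u| <= L * tnorm u) ->
      gamma <= tnorm (dF_adj F x (F x)) -> phi <= `|F x| <= Phi ->
      0 < eta_bar <= eta0 ->
      inexact_newton_eq F sigma_max eta_bar x z ->
      dogleg_choice F delta_min (dF_adj F x z) delta v ->
      eps <= Pred F v.
Proof.
move=> /andP[sm0 sm1] dm0 L0 g0 phi0.
have [Phi0|Phi0] := ltP 0 Phi; last first.
  exists 1 => //; exists 1 => // x z eb d v _ _ /andP[h1 h2]; lra.
pose iota := gamma / 2 / (L ^+ 2 + 1).
pose s0 := Num.min sigma_max phi.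
pose p1 := s0 * iota ^+ 2 / (4 * Phi).
pose p2 := gamma ^+ 2 / (2 * Phi * L ^+ 2).
pose s1 := Num.min delta_min iota / (Phi ^+ 2 / gamma).
have LL0 : 0 < L ^+ 2 + 1 by rewrite ltr_wpDl ?sqr_ge0.
have iota0 : 0 < iota by rewrite !divr_gt0.
have s00 : 0 < s0 by rewrite lt_min sm0.
have p10 : 0 < p1 by rewrite !(divr_gt0, mulr_gt0, exprn_gt0).
have p20 : 0 < p2 by rewrite !(divr_gt0, mulr_gt0, exprn_gt0).
have s10 : 0 < s1 by rewrite divr_gt0 ?lt_min ?dm0// divr_gt0 ?exprn_gt0.
exists (Num.min (s1 * p2) (Num.min p2 p1)).
  by rewrite !lt_min mulr_gt0// p20.
pose eta0 := Num.min 1 (Num.min (gamma / (2 * L * Phi)) (p1 / (2 * Phi))).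
exists eta0.
  by rewrite !lt_min ltr01 !(divr_gt0, mulr_gt0).
move=> x z eb delta v JL gx /andP[phix Phix] /andP[eb0 ebe] newton [vDL /andP[vge _]].
have Fx0 : 0 < `|F x| := lt_le_trans phi0 phix.
have gx0 : dF_adj F x (F x) != 0.
  apply/eqP => gE; move: gx; rewrite gE /tnorm /ip_norm (ip0l (metricP x)) sqrtr0; lra.
have [_ res lt_Fx] := newton.
set sigma := Num.min sigma_max `|F x| in res.
set eta := Num.min eb `|F x| in res.
have sigma_ge : s0 <= sigma by rewrite le_min !ge_min lexx phix orbT.
have sigma_le : sigma <= 1 by rewrite ge_min (ltW sm1).
have sigma01 : 0 <= sigma <= 1 by rewrite sigma_le (le_trans (ltW s00)).
have eta_ge0 : 0 <= eta by rewrite le_min !ltW.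
have [eta1 eta2 eta3] : [/\ eta <= 1, eta <= gamma / (2 * L * Phi)
    & eta <= p1 / (2 * Phi)].
  have : eta <= eta0 by rewrite ge_min ebe.
  by rewrite /eta0 !le_min => /and3P.
have etaF : eta * `|F x| <= eta * Phi by rewrite ler_wpM2l.
have IN_ge : iota <= tnorm (dF_adj F x z).
  apply: le_trans (newton_point_norm_ge (metricP x) (dF_adjP F x) sigma01 (ltW L0) JL res).
  rewrite /iota ler_wpM2r ?invr_ge0 ?(ltW LL0)//.
  have h : L * (eta * `|F x|) <= gamma / 2.
    apply: le_trans (ler_wpM2l (ltW L0) etaF) _.
    rewrite mulrCA -ler_pdivlMr ?mulr_gt0//.
    by move: eta2; congr (_ <= _); field; rewrite !gt_eqF.
  move: gx h; rewrite /tnorm; move: (ip_norm _ _) (L * _) => *; lra.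
have PredIN : p1 <= Pred F (dF_adj F x z).
  apply: le_trans (model_decrease_newton (metricP x) (dF_adjP F x) Fx0 sigma01 eta_ge0 res).
  (* half of this gain pays for the inexactness 2 * eta * |F x| *)
  have h1 : 2 * p1 <= sigma * ip_norm (metric M x) (dF_adj F x z) ^+ 2 / ((1 + eta) * `|F x|).
    rewrite ler_pdivlMr; last by rewrite mulr_gt0 ?ltr_wpDr.
    apply: (@le_trans _ _ (2 * p1 * (2 * Phi))).
      apply: ler_wpM2l; first by rewrite mulr_ge0 ?(ltW p10).
      by apply: ler_pM => //; rewrite ?addr_ge0//; lra.
    rewrite (_ : _ * (2 * Phi) = s0 * iota ^+ 2); last first.
      by rewrite /p1; field; rewrite gt_eqF.
    rewrite ler_pM ?(ltW s00) ?sqr_ge0//.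
    by rewrite ler_sqr ?nnegrE ?(ltW iota0) ?ip_norm_ge0.
  have h2 : 2 * eta * `|F x| <= p1.
    move: eta3; rewrite ler_pdivlMr ?mulr_gt0//; move: etaF.
    by move: (`|F x|) (p1) => *; lra.
  move: h1 h2; move: (_ / _) (2 * eta * _) => *; lra.
have PredCP : p2 <= Pred F (cauchy_point F x).
  apply: le_trans (model_decrease_cauchy_ge (metricP x) (dF_adjP F x) _ _ Fx0 L0 JL).
  rewrite ler_pM ?sqr_ge0 ?invr_ge0 ?mulr_ge0 ?(ltW L0) ?(ltW Phi0)//.
    by rewrite ler_sqr ?nnegrE ?(ltW g0) ?ip_norm_ge0.
  rewrite lef_pV2 ?posrE ?mulr_gt0 ?exprn_gt0//.
  by rewrite ler_wpM2r ?sqr_ge0// ler_wpM2l.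
have CPle : tnorm (cauchy_point F x) <= Phi ^+ 2 / gamma.
  apply: le_trans (cauchy_point_norm_le (metricP x) (dF_adjP F x) _ gx0) _.
  rewrite ler_pM ?sqr_ge0 ?invr_ge0 ?ip_norm_ge0//.
    by rewrite ler_sqr ?nnegrE ?(ltW Phi0).
  by rewrite lef_pV2 ?posrE ?(lt_le_trans g0 gx).
case: (dogleg_curve_Pred _ _ _ vDL) => [[s sge0 [vE]]|]; apply: le_trans; last first.
  by rewrite ge_min; apply/orP; right; rewrite le_min !ge_min PredCP PredIN orbT.
rewrite ge_min; apply/orP; left; rewrite ler_pM ?(ltW s10) ?(ltW p20)//.
rewrite /s1 ler_pdivrMr ?divr_gt0 ?exprn_gt0//.
apply: (@le_trans _ _ (tnorm v)).
  by apply: le_trans vge; rewrite le_min !ge_min lexx IN_ge orbT.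
by rewrite vE /tnorm (ip_normZ (metricP x)) (ger0_norm sge0) ler_wpM2l.
Qed.

End DoglegBounds.

(** * Convergence *)

Lemma nonincreasing_drops_vanish (R : realType) (u : R^nat) (e : R) :
  0 < e -> (forall k, 0 <= u k) -> (forall k, u k.+1 <= u k) ->
  \forall k \near \oo, u k - u k.+1 < e.
Proof.
move=> e0 u0 udec.
have ucvg : cvgn u.
  apply: nonincreasing_is_cvgn; first exact/nonincreasing_seqP.
  by exists 0 => _ [k _ <-].
have drop : (u k - u k.+1) @[k --> \oo] --> (0 : R).
  rewrite -(subrr (limn u)); apply: cvgB; first exact: ucvg.
  by rewrite (cvg_shiftS u).
exact: cvgr_lt drop _ e0.
Qed.

Section DoglegMethod.
Context {R : realType} {m n : nat} {M : riemannianManifold R m}.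
Context {E : euclideanSpace R n} {retr : forall p : M, tangent p -> M} {F : M -> E}.
Context {t sigma_max theta_max delta_min : R}.

Lemma reduction_loop_accepts x (IN : tangent x) delta v v' :
  reduction_loop retr F t theta_max delta_min IN delta v v' ->
  dogleg_choice F delta_min IN delta v ->
  t * Pred F v' <= Ared retr F v' /\
  exists delta', dogleg_choice F delta_min IN delta' v'.
Proof.
by elim=> {delta v v'} [delta v acc choice|delta v th v1 v' _ _ _ c1 _ IH _];
  [split => //; exists delta | exact: IH].
Qed.

Lemma dogleg_iteration_decrease eta_bar delta x x' :
  dogleg_iteration retr F t sigma_max theta_max delta_min eta_bar delta x x' ->
  exists z delta' (v : tangent x),
    [/\ inexact_newton_eq F sigma_max eta_bar x z,
        dogleg_choice F delta_min (dF_adj F x z) delta' v &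
        t * Pred F v <= `|F x| - `|F x'|].
Proof.
case=> z [v [v' [newton choice loop ->]]].
have [acc [delta' choice']] := reduction_loop_accepts _ _ _ _ _ loop choice.
by exists z, delta', v'.
Qed.

End DoglegMethod.

Theorem theorem3p10 (R : realType) (m n : nat)
    (M : riemannianManifold R m) (E : euclideanSpace R n) (dimME : (n < m)%N)
    (retr : forall p : M, tangent p -> M) (retrP : retraction retr)
    (F : M -> E) (F_diff : forall p, differentiable_at F p)
    (t sigma_max theta_max delta_min delta0 : R) (eta_bar : nat -> R)
    (t01 : 0 < t < 1) (sigma01 : 0 < sigma_max < 1)
    (theta01 : 0 < theta_max < 1) (delta_min01 : 0 < delta_min < 1)
    (delta0_ge : delta_min <= delta0)
    (eta01 : forall k, 0 < eta_bar k < 1) (eta_cvg : eta_bar @ \oo --> (0 : R))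
    (x0 : M)
    (F_C1 : continuously_differentiable_on [set p | `|F p| <= `|F x0|] F)
    (x : nat -> M)
    (x_gen : generated_by_dogleg retr F t sigma_max theta_max delta_min
               eta_bar delta0 x0 x)
    (xbar : M) (xbar_acc : cluster (x @ \oo) xbar) :
  grad (fun p => 2^-1 * `|F p| ^+ 2) xbar = dF_adj F xbar (F xbar) /\
  dF_adj F xbar (F xbar) = 0.
Proof.
split; first exact: grad_half_sqr_norm.
have [x0E [delta [_ _ iter]]] := x_gen.
have [t0 _] := andP t01; have [dm0 _] := andP delta_min01.
have Fx_dec k : `|F (x k.+1)| <= `|F (x k)|.
  have [z [d [v [newton [vDL _] dec]]]] := dogleg_iteration_decrease _ _ _ _ (iter k).
  rewrite -subr_ge0; apply: le_trans dec.
  by rewrite mulr_ge0 ?(ltW t0)// (dogleg_Pred_ge0 F _ _ _ _ _ newton).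
pose A := [set p : M | `|F p| <= `|F x0|].
have Ax k : A (x k).
  elim: k => [|k IH]; first by rewrite /A/= x0E.
  exact: le_trans (Fx_dec k) IH.
have Fcvg := differentiable_at_cvg _ _ _ (F_diff xbar).
(* the level set is closed at xbar, F being continuous there *)
have Axbar : A xbar.
  rewrite /A/= leNgt; apply/negP => lt_x0.
  have near_gt : \forall q \near xbar, `|F x0| < `|F q|.
    by apply: (cvgr_gt `|F xbar|) => //; exact: cvg_norm.
  have all_A : (x @ \oo) A by exists 0%N => // k _; exact: Ax.
  have [q [Aq]] := xbar_acc _ _ all_A near_gt.
  by rewrite ltNge; rewrite /A/= in Aq; rewrite Aq.
apply/eqP; apply: contraT => g0.
have Fxbar0 : 0 < `|F xbar|.
  rewrite normr_gt0; apply/eqP => Fx0.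
  have := ip_pos (metricP xbar) g0.
  by rewrite dF_adjP Fx0 (ip0l (@dotP _ _ E)) ltxx.
have [L L0 near_L] := differential_bounded_near F_C1 Axbar.
have [gamma gamma0 near_gamma] := gradient_bounded_below_near F_C1 Axbar g0.
have phi0 : 0 < `|F xbar| / 2 by rewrite divr_gt0.
have [eps eps0 [eta0 eta00 Pred_ge]] := dogleg_Pred_bounded_below F
  _ _ _ _ _ (`|F xbar| + 1) sigma01 dm0 L0 gamma0 phi0.
have near_F : \forall q \near xbar, `|F xbar| / 2 <= `|F q| <= `|F xbar| + 1.
  have Fn : `|F q| @[q --> xbar] --> `|F xbar| by exact: cvg_norm.
  have gt_half : `|F xbar| / 2 < `|F xbar| by rewrite ltr_pdivrMr// ltr_pMr// ltr1n.
  have lt_succ : `|F xbar| < `|F xbar| + 1 by rewrite ltrDl.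
  by apply: filterS2 (cvgr_gt _ Fn _ gt_half) (cvgr_lt _ Fn _ lt_succ) => q /ltW -> /ltW ->.
have near_eta : \forall k \near \oo, eta_bar k < eta0.
  exact: cvgr_lt eta_cvg _ eta00.
have teps : 0 < t * eps by rewrite mulr_gt0.
have drops := nonincreasing_drops_vanish _ (fun k => `|F (x k)|) _ teps
  (fun k => normr_ge0 _) Fx_dec.
(* late iterates, described as points so that they can be met near xbar *)
pose small_drop := [set q | exists k, [/\ q = x k, eta_bar k < eta0 &
  `|F (x k)| - `|F (x k.+1)| < t * eps]].
have tail : (x @ \oo) small_drop.
  suff: \forall k \near \oo, small_drop (x k) by [].
  by apply: filterS2 near_eta drops => k ek dk; exists k.
have near_good : \forall q \near xbar, A q ->
    [/\ forall u : tangent q, `|differential F u| <= L * tnorm u,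
        gamma <= tnorm (dF_adj F q (F q)) &
        `|F xbar| / 2 <= `|F q| <= `|F xbar| + 1].
  apply: filterS3 (near_L : \forall q \near xbar, A q -> _)
    (near_gamma : \forall q \near xbar, A q -> _) near_F => q Lq gq Fq Aq.
  by split; [exact: Lq | exact: gq | exact: Fq].
have [q [[k [-> ek dk]] /(_ (Ax k)) [Lk gk Fk]]] := xbar_acc _ _ tail near_good.
have [z [d [v [newton choice dec]]]] := dogleg_iteration_decrease _ _ _ _ (iter k).
have [ek0 _] := andP (eta01 k).
have := Pred_ge _ z (eta_bar k) d v Lk gk Fk _ newton choice.
rewrite ek0 (ltW ek) => /(_ isT) eps_le.
have := ler_wpM2l (ltW t0) eps_le; move: dec dk.
by move: (`|F (x k)| - _) (t * Pred F v) (t * eps) => *; lra.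
Qed.
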